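(* If $\theta=\theta(x)$ is a solution of the sine-Gordon equation $$\Delta\theta=-2\sin(2\theta),$$ then the associated solution $w$ of the sinh-Gordon equation is $$\tanh\frac{w(x,y)}{2}=F(x)G(y)=\frac{\sqrt{ab}\,\tan\!\left(\frac{\sqrt{ab}}{2}\,y+k\right)}{\theta'(x)-2\cos\theta(x)},$$ where $a=2\cos\theta(0)+\theta'(0)$, $b=2\cos\theta(0)-\theta'(0)$, and $k\in\mathbb{C}$ is such that $\tanh\frac{w(0,0)}{2}=-\sqrt{\frac{a}{b}}\,\tan(k)$. The formula holds true also for the case $ab<0$.
   Context: Here $\Delta=\partial_{xx}^2+\partial_{yy}^2$ is the flat Laplacian in the variables $(x,y)$, and $\theta=\theta(x)$ means that $\theta$ depends only on $x$. The product $F(x)G(y)$ denotes a product of a function $F$ of $x$ alone and a function $G$ of $y$ alone. The sinh-Gordon equation is $\Delta w=2\sinh(2w)$. The solution $w=w(x,y)$ associated to $\theta$ is the one determined by the Bäcklund transformation, that is, the pair $(w,\theta)$ satisfies $$\partial_x w-\partial_y\theta=-2\sinh w\,\sin\theta,\qquad \partial_y w+\partial_x\theta=-2\cosh w\,\cos\theta,$$ a system which connects solutions $w$ of the sinh-Gordon equation with solutions $\theta$ of the sine-Gordon equation.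
   Formalization: The square roots are any complex roots related by √(ab) = b·√(a/b), which holds for principal roots when b > 0; with principal roots and b < 0 the stated formula has the wrong sign (e.g. θ = π, a = b = −2, w(0,0) ≠ 0). *)

(* Defs.v *)
From Stdlib Require Import Reals.
From Coquelicot Require Import Coquelicot.
Open Scope R_scope.

Definition connected_set (D : R * R -> Prop) : Prop :=
  forall U V : R * R -> Prop,
    open U -> open V ->
    (forall p, D p -> U p \/ V p) ->
    (exists p, D p /\ U p) ->
    (exists p, D p /\ V p) ->
    exists p, D p /\ U p /\ V p.

Definition plane_domain (D : R * R -> Prop) : Prop := open D /\ connected_set D.

Definition laplacian (f : R -> R -> R) (x y : R) : R :=
  partial_derive 2 0 f x y + partial_derive 0 2 f x y.

(* Solutions are classical.  [Derive] is total, hence the explicit C^2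
   requirement [ex_diff_n _ 2]. *)
Definition sinh_gordon (D : R * R -> Prop) (w : R -> R -> R) : Prop :=
  forall x y, D (x, y) ->
    ex_diff_n w 2 x y /\ laplacian w x y = 2 * sinh (2 * w x y).

Definition sine_gordon (D : R * R -> Prop) (theta : R -> R -> R) : Prop :=
  forall x y, D (x, y) ->
    ex_diff_n theta 2 x y /\ laplacian theta x y = - 2 * sin (2 * theta x y).

Definition backlund (D : R * R -> Prop) (w theta : R -> R -> R) : Prop :=
  forall x y, D (x, y) ->
    partial_derive 1 0 w x y - partial_derive 0 1 theta x y
      = - 2 * sinh (w x y) * sin (theta x y) /\
    partial_derive 0 1 w x y + partial_derive 1 0 theta x y
      = - 2 * cosh (w x y) * cos (theta x y).

Definition Cexp (z : C) : C :=
  (exp (fst z) * cos (snd z), exp (fst z) * sin (snd z)).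

Definition Ccos (z : C) : C :=
  ((Cexp (Ci * z) + Cexp (- (Ci * z))) / RtoC 2)%C.

Definition Csin (z : C) : C :=
  ((Cexp (Ci * z) - Cexp (- (Ci * z))) / (RtoC 2 * Ci))%C.

(* Meaningful only where [Ccos z <> 0]. *)
Definition Ctan (z : C) : C := (Csin z / Ccos z)%C.

(* [rab] and [rq] are values of sqrt(ab) and sqrt(a/b), for real a, b of any
   sign with b <> 0.  The last clause makes the two choices compatible:
   sqrt(ab) = b sqrt(a/b), equivalently sqrt(ab) = sqrt a sqrt b and
   sqrt(a/b) = sqrt a / sqrt b for common square roots of a and b.  For b > 0
   the principal values are such a pair; for b < 0 (and a <> 0) they differ
   by a sign from one. *)
Definition compatible_roots (a b : R) (rab rq : C) : Prop :=
  (rab * rab)%C = RtoC (a * b) /\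
  (rq * rq)%C = RtoC (a / b) /\
  rab = (RtoC b * rq)%C.

(* Main.v *)
Require Import Defs.
From Stdlib Require Import Reals Lra.
From Coquelicot Require Import Coquelicot.
Open Scope R_scope.

(** Put [T = tanh (w / 2)], [p = theta' - 2 cos theta], [q = theta' + 2 cos theta].
    Since [theta] depends on [x] only, the half-argument formulas turn the
    Bäcklund system into
      [T_x = - 2 sin theta T],   [T_y = - (q - p T^2) / 2],
    and the sine-Gordon equation [theta'' = - 2 sin (2 theta)] says that
      [p' = 2 sin theta p],   [q' = - 2 sin theta q].
    Hence [p q] is constant, equal to [- a b], and [S = p T] satisfies
      [S_x = 0],   [S_y = (S^2 + a b) / 2].
    So [S] solves a Riccati equation in [y] alone, of which
    [r tan (r y / 2 + k)] with [r^2 = a b] is a solution; dividing by [p] gives the formula.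

    Two points need care.  The domain is only open and connected, so a
    function with vanishing [x]-derivative is constant along horizontal lines
    only locally.  And the tangent may have poles, so [S] cannot be
    compared with it directly.  Both difficulties disappear after linearisation:
    with [A = cos (r y / 2 + k)] and [B = r sin (r y / 2 + k)], the difference [E = S A - B] satisfies the linear
    system [E_x = 0], [E_y = (S / 2) E], whose coefficient [S] is real, and
    [E = 0] at the origin.  A linear total differential equation on a connected
    open set has only the zero solution once it vanishes at a point
    ([linear_total_equation_zero]), so [S A = B] everywhere
    ([riccati_quotient]).  A zero of [A] would be a zero of [B], which
    [sin^2 + cos^2 = 1] excludes for [r <> 0]; for [r = 0] the function [A] is
    the nonzero constant [cos k] ([riccati_tangent]).  The same uniqueness
    principle shows that [p] has no zero and that [p q] is constant
    ([theta_factors]). *)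

(** * A uniqueness principle on connected plane domains *)

(** Gronwall's argument: with [c = 2 M] to the right of [t0] and [c = - 2 M] to
    its left, the nonnegative function [f^2 exp (- c s)] does not increase as
    [s] moves away from [t0], where it vanishes.  Assuming a bound on [g]
    instead of continuity avoids integrating [g]. *)
Lemma linear_ode_zero (f g : R -> R) (M t0 t : R) :
  (forall s, Rmin t0 t <= s <= Rmax t0 t ->
     is_derive f s (g s * f s) /\ Rabs (g s) <= M) ->
  f t0 = 0 -> f t = 0.
Proof.
  intros H Hf0.
  set (c := if Rle_dec t0 t then 2 * M else - (2 * M)).
  set (h := fun s => f s * f s * exp (- c * s)).
  assert (Hd : forall s, Rmin t0 t <= s <= Rmax t0 t ->
    is_derive h s ((2 * g s - c) * (f s * f s * exp (- c * s)))).
  { intros s Hs. destruct (H s Hs) as [Hf _]. unfold h.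
    assert (Hx : Derive (fun r => f r) s = g s * f s) by exact (is_derive_unique _ _ _ Hf).
    auto_derive.
    - repeat split; exists (g s * f s); exact Hf.
    - rewrite Hx. ring. }
  destruct (MVT_gen h t0 t (fun s => (2 * g s - c) * (f s * f s * exp (- c * s))))
    as [s [Hs E]].
  - intros s Hs. apply Hd. lra.
  - intros s Hs. apply continuity_pt_filterlim.
    apply (ex_derive_continuous h s). eexists. apply Hd, Hs.
  - destruct (H s Hs) as [_ HM].
    assert (E0 : h t0 = 0) by (unfold h; rewrite Hf0; ring).
    assert (Hsign : (2 * g s - c) * (t - t0) <= 0).
    { apply Rabs_le_between in HM. unfold c. destruct (Rle_dec t0 t); nra. }
    assert (He := exp_pos (- c * s)). assert (He' := exp_pos (- c * t)).
    assert (Hh : h t <= 0).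
    { assert (Hpos : 0 <= f s * f s * exp (- c * s)) by (apply Rmult_le_pos; nra).
      nra. }
    unfold h in Hh. destruct (Req_dec (f t) 0) as [|Hne]; [assumption|].
    assert (Hsq : 0 < f t * f t) by nra.
    assert (Hpos := Rmult_lt_0_compat _ _ Hsq He'). lra.
Qed.

Lemma continuity_2d_pt_locally_bounded (f : R -> R -> R) (x y : R) :
  continuity_2d_pt f x y ->
  locally_2d (fun u v => Rabs (f u v) <= Rabs (f x y) + 1) x y.
Proof.
  intros Hf. destruct (Hf (mkposreal 1 Rlt_0_1)) as [d Hd].
  exists d. intros u v Hu Hv. specialize (Hd u v Hu Hv). simpl in Hd.
  apply Rabs_def2 in Hd. unfold Rabs. repeat destruct Rcase_abs; lra.
Qed.

(** The zero set of [f] is open because a nearby point is joined to a zero by a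
    horizontal and then a vertical segment, on each of which [f] solves a linear
    ordinary equation; its complement is open by continuity.  Connectedness
    concludes. *)
Lemma linear_total_equation_zero (D : R * R -> Prop) (f g h : R -> R -> R) :
  plane_domain D ->
  (forall x y, D (x, y) ->
     continuity_2d_pt f x y /\ continuity_2d_pt g x y /\ continuity_2d_pt h x y) ->
  (forall x y, D (x, y) ->
     is_derive (fun t => f t y) x (g x y * f x y) /\
     is_derive (fun t => f x t) y (h x y * f x y)) ->
  forall x0 y0, D (x0, y0) -> f x0 y0 = 0 ->
  forall x y, D (x, y) -> f x y = 0.
Proof.
  intros [HO HC] Hc Hd x0 y0 H0 Hf0 x y Hxy.
  destruct (Req_dec (f x y) 0) as [|Hne]; [assumption|exfalso].
  assert (HD : forall u v, D (u, v) -> locally_2d (fun a b => D (a, b)) u v).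
  { intros u v Huv. apply locally_2d_locally.
    refine (filter_imp _ _ _ (HO _ Huv)). now intros [a b]. }
  destruct (HC (fun p => D (fst p, snd p) /\ f (fst p) (snd p) = 0)
               (fun p => D (fst p, snd p) /\ f (fst p) (snd p) <> 0)) as [p [_ [[_ H1] [_ H2]]]].
  - intros [u v] [Huv Hz]. simpl in Hz.
    apply (proj1 (locally_2d_locally (fun a b => D (a, b) /\ f a b = 0) u v)).
    destruct (Hc u v Huv) as [_ [Hg Hh]].
    destruct (locally_2d_and _ _ _ _ (HD u v Huv)
      (locally_2d_and _ _ _ _ (continuity_2d_pt_locally_bounded _ _ _ Hg)
         (continuity_2d_pt_locally_bounded _ _ _ Hh))) as [d Hbox].
    assert (Hseg : forall r s t : R, Rmin r s <= t <= Rmax r s ->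
      Rabs (s - r) < d -> Rabs (t - r) < d).
    { intros r s t. unfold Rmin, Rmax, Rabs.
      destruct (Rle_dec r s); repeat destruct Rcase_abs; lra. }
    assert (Hr : forall r : R, Rabs (r - r) < d).
    { intros r. rewrite Rminus_diag, Rabs_R0. apply cond_pos. }
    exists d. intros a b Ha Hb. split; [now apply Hbox|].
    (* Horizontally from (u, v) to (a, v), then vertically to (a, b). *)
    assert (Hav : f a v = 0).
    { apply (linear_ode_zero (fun t => f t v) (fun t => g t v)
               (Rabs (g u v) + 1) u a); [|exact Hz].
      intros s Hs. destruct (Hbox s v (Hseg _ _ _ Hs Ha) (Hr v)) as [HDs [Hgs _]].
      split; [apply Hd, HDs|exact Hgs]. }
    apply (linear_ode_zero (fun t => f a t) (fun t => h a t)
             (Rabs (h u v) + 1) v b); [|exact Hav].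
    intros s Hs. destruct (Hbox a s Ha (Hseg _ _ _ Hs Hb)) as [HDs [_ Hhs]].
    split; [apply Hd, HDs|exact Hhs].
  - intros [u v] [Huv Hz]. simpl in Hz.
    apply (proj1 (locally_2d_locally (fun a b => D (a, b) /\ f a b <> 0) u v)).
    apply locally_2d_and; [now apply HD|].
    apply continuity_2d_pt_neq_0; [now apply Hc|exact Hz].
  - intros [u v] Huv. simpl. destruct (Req_dec (f u v) 0); tauto.
  - now exists (x0, y0).
  - now exists (x, y).
  - now apply H2.
Qed.

(** * Complex sine and cosine along an affine line *)

Lemma Ccos_parts (u v : R) : Ccos (u, v) = (cos u * cosh v, - (sin u * sinh v)).
Proof.
  unfold Ccos, Cexp, cosh, sinh, Ci, RtoC, Cdiv, Cinv, Cmult, Cplus, Copp; simpl.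
  replace (0 * u - 1 * v) with (- v) by ring.
  replace (0 * v + 1 * u) with u by ring.
  rewrite Ropp_involutive, cos_neg, sin_neg.
  f_equal; field.
Qed.

Lemma Csin_parts (u v : R) : Csin (u, v) = (sin u * cosh v, cos u * sinh v).
Proof.
  unfold Csin, Cexp, cosh, sinh, Ci, RtoC, Cdiv, Cinv, Cmult, Cminus, Cplus, Copp; simpl.
  replace (0 * u - 1 * v) with (- v) by ring.
  replace (0 * v + 1 * u) with u by ring.
  rewrite Ropp_involutive, cos_neg, sin_neg.
  f_equal; field.
Qed.

Lemma Csin2_Ccos2 (z : C) : (Csin z * Csin z + Ccos z * Ccos z)%C = RtoC 1.
Proof.
  destruct z as [u v]. rewrite Ccos_parts, Csin_parts.
  assert (Ht := sin2_cos2 u). unfold Rsqr in Ht.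
  assert (Hh : cosh v * cosh v - sinh v * sinh v = 1).
  { unfold cosh, sinh. assert (E := exp_plus v (- v)).
    rewrite Rplus_opp_r, exp_0 in E. nra. }
  unfold RtoC, Cmult, Cplus; simpl. f_equal; [|ring].
  replace 1 with ((sin u * sin u + cos u * cos u) * (cosh v * cosh v - sinh v * sinh v))
    by (rewrite Ht, Hh; ring).
  ring.
Qed.

Lemma Cline_parts (c1 c2 k1 k2 t : R) :
  ((c1, c2) * RtoC t + (k1, k2))%C = (c1 * t + k1, c2 * t + k2).
Proof. unfold Cmult, Cplus, RtoC; simpl; f_equal; ring. Qed.

Lemma is_derive_Ccos_line (c k : C) (y : R) :
  is_derive (fun t => fst (Ccos (c * RtoC t + k)%C)) y
    (- fst (c * Csin (c * RtoC y + k))%C) /\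
  is_derive (fun t => snd (Ccos (c * RtoC t + k)%C)) y
    (- snd (c * Csin (c * RtoC y + k))%C).
Proof.
  destruct c as [c1 c2], k as [k1 k2].
  split; (eapply is_derive_ext;
    [intros t; rewrite Cline_parts, Ccos_parts; reflexivity|]);
    rewrite Cline_parts, Csin_parts; simpl; unfold cosh, sinh; auto_derive; trivial; field.
Qed.

Lemma is_derive_Csin_line (c k : C) (y : R) :
  is_derive (fun t => fst (Csin (c * RtoC t + k)%C)) y
    (fst (c * Ccos (c * RtoC y + k))%C) /\
  is_derive (fun t => snd (Csin (c * RtoC t + k)%C)) y
    (snd (c * Ccos (c * RtoC y + k))%C).
Proof.
  destruct c as [c1 c2], k as [k1 k2].
  split; (eapply is_derive_ext;
    [intros t; rewrite Cline_parts, Csin_parts; reflexivity|]);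
    rewrite Cline_parts, Ccos_parts; simpl; unfold cosh, sinh; auto_derive; trivial; field.
Qed.

(** * The hyperbolic tangent of a half argument *)

Lemma is_derive_cosh (x : R) : is_derive cosh x (sinh x).
Proof. apply is_derive_Reals, derivable_pt_lim_cosh. Qed.

Lemma is_derive_sinh (x : R) : is_derive sinh x (cosh x).
Proof. apply is_derive_Reals, derivable_pt_lim_sinh. Qed.

(** The double-argument formulas [sinh x = 2 T / (1 - T^2)] and
    [cosh x = (1 + T^2) / (1 - T^2)] for [T = tanh (x / 2)], free of division so
    that they can be substituted into [(1 - T^2) w_x] and [(1 - T^2) w_y]. *)
Lemma tanh_half (x : R) :
  (1 - tanh (x / 2) * tanh (x / 2)) * sinh x = 2 * tanh (x / 2) /\
  (1 - tanh (x / 2) * tanh (x / 2)) * cosh x = 1 + tanh (x / 2) * tanh (x / 2).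
Proof.
  assert (E : exp x = exp (x / 2) * exp (x / 2)) by (rewrite <- exp_plus; f_equal; field).
  assert (E' : exp (- x) = / exp (x / 2) * / exp (x / 2))
    by (rewrite exp_Ropp, E; field; apply Rgt_not_eq, exp_pos).
  assert (Hp := exp_pos (x / 2)).
  unfold tanh, sinh, cosh. rewrite E', E, exp_Ropp.
  split; field; split; nra.
Qed.

Lemma is_derive_tanh (x : R) : is_derive tanh x (1 - tanh x * tanh x).
Proof.
  assert (Hc : 0 < cosh x).
  { unfold cosh. assert (H := exp_pos x). assert (H' := exp_pos (- x)). lra. }
  unfold tanh.
  eapply (is_derive_ext (fun t => sinh t / cosh t)); [reflexivity|].
  evar_last.
  - apply (is_derive_div sinh cosh x _ _ (is_derive_sinh x) (is_derive_cosh x)). lra.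
  - field. lra.
Qed.

(** * Linearisation of the Riccati equation *)

(** [B / A] solves the Riccati equation [u' = (u^2 + c) / 2] whenever
    [A' = - B / 2] and [B' = c A / 2].  In cross-multiplied form
    [E = S A - B] one finds [E_y = (S / 2) E], so poles of [B / A] do no harm.
    As [S] and [c] are real, the real and imaginary parts of a complex pair
    [(A, B)] can be treated separately. *)
Lemma riccati_quotient (D : R * R -> Prop) (S : R -> R -> R) (A B : R -> R) (c : R) :
  plane_domain D -> D (0, 0) ->
  (forall x y, D (x, y) ->
     continuity_2d_pt S x y /\
     is_derive (fun t => S t y) x 0 /\
     is_derive (fun t => S x t) y ((S x y * S x y + c) / 2)) ->
  (forall y, is_derive A y (- B y / 2) /\ is_derive B y (c / 2 * A y)) ->
  S 0 0 * A 0 = B 0 ->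
  forall x y, D (x, y) -> S x y * A y = B y.
Proof.
  intros HD H0 HS HAB Hi x y Hxy.
  assert (Hc1 : forall (u : R -> R) (l r s : R), is_derive u s l ->
            continuity_2d_pt (fun _ t => u t) r s).
  { intros u l r s Hu. apply (continuity_1d_2d_pt_comp u (fun _ t => t)).
    - apply continuity_pt_filterlim. apply (ex_derive_continuous u s). now exists l.
    - apply continuity_2d_pt_id2. }
  apply Rminus_diag_uniq.
  apply (linear_total_equation_zero D (fun x y => S x y * A y - B y)
           (fun _ _ => 0) (fun x y => S x y * / 2) HD) with (x0 := 0) (y0 := 0);
    [| |assumption|lra|assumption].
  - intros r s Hrs. destruct (HS r s Hrs) as [HSc _]. destruct (HAB s) as [HA HB].
    repeat split.
    + apply continuity_2d_pt_minus; [apply continuity_2d_pt_mult|]; eauto.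
    + apply continuity_2d_pt_const.
    + apply continuity_2d_pt_mult; [assumption|apply continuity_2d_pt_const].
  - intros r s Hrs. destruct (HS r s Hrs) as [_ [HSx HSy]].
    destruct (HAB s) as [HA HB].
    split.
    + evar_last.
      * apply (is_derive_minus (fun t => S t s * A s) (fun _ => B s)).
        -- apply (is_derive_mult (fun t => S t s) (fun _ => A s));
             [exact HSx|apply is_derive_const|exact Rmult_comm].
        -- apply is_derive_const.
      * unfold minus, plus, opp, mult, zero; simpl. ring.
    + evar_last.
      * apply (is_derive_minus (fun t => S r t * A t) B); [|exact HB].
        apply (is_derive_mult (fun t => S r t) A); [exact HSy|exact HA|exact Rmult_comm].
      * unfold minus, plus, opp, mult; simpl. field.
Qed.

(** * The Bäcklund system for a sine-Gordon solution of one variable *)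

Lemma sine_gordon_of_x (D : R * R -> Prop) (theta : R -> R) (x y : R) :
  sine_gordon D (fun x _ => theta x) -> D (x, y) ->
  continuity_2d_pt (fun u _ => theta u) x y /\
  continuity_2d_pt (fun u _ => Derive theta u) x y /\
  is_derive theta x (Derive theta x) /\
  is_derive (Derive theta) x (- 2 * sin (2 * theta x)).
Proof.
  intros H Hxy. destruct (H x y Hxy) as [[Hc [H1 [_ [[Hc' [H2 _]] _]]]] HL].
  split; [|split; [|split]].
  - exact Hc.
  - exact Hc'.
  - now apply Derive_correct.
  - evar_last; [apply Derive_correct; exact H2|].
    unfold laplacian, partial_derive in HL; simpl in HL.
    rewrite (Derive_ext (Derive (fun _ => theta x)) (fun _ => 0)), Derive_const, Rplus_0_r
      in HL by (intros t; apply Derive_const).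
    exact HL.
Qed.

(** Both identities are [theta'' = - 4 sin theta cos theta], factored; they make
    the first integral [theta'^2 - 4 cos^2 theta] a product of two solutions of
    linear equations with opposite coefficients. *)
Lemma is_derive_theta_combinations (theta : R -> R) (x : R) :
  is_derive theta x (Derive theta x) ->
  is_derive (Derive theta) x (- 2 * sin (2 * theta x)) ->
  is_derive (fun t => Derive theta t - 2 * cos (theta t)) x
    (2 * sin (theta x) * (Derive theta x - 2 * cos (theta x))) /\
  is_derive (fun t => Derive theta t + 2 * cos (theta t)) x
    (- (2 * sin (theta x)) * (Derive theta x + 2 * cos (theta x))).
Proof.
  intros H1 H2.
  assert (Hcos : is_derive (fun t => 2 * cos (theta t)) x
                   (2 * (- sin (theta x) * Derive theta x))).
  { evar_last.
    - apply (is_derive_scal (fun t => cos (theta t))).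
      apply (is_derive_comp cos theta);
        [apply is_derive_Reals, derivable_pt_lim_cos|exact H1].
    - unfold scal; simpl; unfold mult; simpl. ring. }
  rewrite sin_2a in H2.
  split; evar_last.
  - exact (is_derive_minus _ _ _ _ _ H2 Hcos).
  - unfold minus, plus, opp; simpl. ring.
  - exact (is_derive_plus _ _ _ _ _ H2 Hcos).
  - unfold plus; simpl. ring.
Qed.

Lemma is_derive_tanh_half (u : R -> R) (x l : R) :
  is_derive u x l ->
  is_derive (fun t => tanh (u t / 2)) x
    ((1 - tanh (u x / 2) * tanh (u x / 2)) * (l / 2)).
Proof.
  intros Hu. evar_last.
  - apply (is_derive_comp tanh (fun t => u t / 2)); [apply is_derive_tanh|].
    apply (is_derive_ext (fun t => / 2 * u t)); [intros t; unfold Rdiv; apply Rmult_comm|].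
    apply (is_derive_scal u); exact Hu.
  - unfold scal; simpl; unfold mult; simpl. field.
Qed.

(** The two hyperbolic functions in the Bäcklund system become polynomial in
    [T = tanh (w / 2)]: linear for the [x]-equation, Riccati for the
    [y]-equation. *)
Lemma backlund_tanh_half (D : R * R -> Prop) (theta : R -> R) (w : R -> R -> R) (x y : R) :
  sinh_gordon D w -> backlund D w (fun x _ => theta x) -> D (x, y) ->
  is_derive (fun t => tanh (w t y / 2)) x
    (- (2 * sin (theta x)) * tanh (w x y / 2)) /\
  is_derive (fun t => tanh (w x t / 2)) y
    (- ((Derive theta x + 2 * cos (theta x))
        - (Derive theta x - 2 * cos (theta x)) * (tanh (w x y / 2) * tanh (w x y / 2))) / 2).
Proof.
  intros Hw HB Hxy.
  destruct (Hw x y Hxy) as [[_ [H1 [H2 _]]] _].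
  destruct (HB x y Hxy) as [E1 E2].
  unfold partial_derive in E1, E2; simpl in E1, E2.
  rewrite Derive_const in E1.
  change (Derive (fun t => w x t) y + Derive theta x
          = - 2 * cosh (w x y) * cos (theta x)) in E2.
  assert (Hx : is_derive (fun t => w t y) x (- 2 * sinh (w x y) * sin (theta x))).
  { rewrite <- E1, Rminus_0_r. now apply Derive_correct. }
  assert (Hy : is_derive (fun t => w x t) y
                 (- 2 * cosh (w x y) * cos (theta x) - Derive theta x)).
  { rewrite <- E2. unfold Rminus. rewrite Rplus_assoc, Rplus_opp_r, Rplus_0_r.
    now apply Derive_correct. }
  destruct (tanh_half (w x y)) as [Hs Hc].
  split; (evar_last; [apply is_derive_tanh_half; eassumption|]); simpl.
  - transitivity (- sin (theta x)
      * ((1 - tanh (w x y / 2) * tanh (w x y / 2)) * sinh (w x y)));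
      [field|rewrite Hs; ring].
  - transitivity (- cos (theta x)
        * ((1 - tanh (w x y / 2) * tanh (w x y / 2)) * cosh (w x y))
      - (1 - tanh (w x y / 2) * tanh (w x y / 2)) * Derive theta x / 2);
      [field|rewrite Hc; field].
Qed.

(** * The explicit formula *)

(** The sine-Gordon equation holds only on the projection of [D], so [p] and
    [p q] are regarded as functions on [D], where uniqueness applies: a zero of
    [p] would propagate to the origin, and [p q] has zero gradient. *)
Lemma theta_factors (D : R * R -> Prop) (theta : R -> R) :
  plane_domain D -> D (0, 0) ->
  sine_gordon D (fun x _ => theta x) ->
  Derive theta 0 - 2 * cos (theta 0) <> 0 ->
  forall x y, D (x, y) ->
  Derive theta x - 2 * cos (theta x) <> 0 /\
  (Derive theta x - 2 * cos (theta x)) * (Derive theta x + 2 * cos (theta x))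
  = (Derive theta 0 - 2 * cos (theta 0)) * (Derive theta 0 + 2 * cos (theta 0)).
Proof.
  intros HD H0 Htheta Hp0.
  set (p := fun t => Derive theta t - 2 * cos (theta t)).
  set (q := fun t => Derive theta t + 2 * cos (theta t)).
  assert (Hcont : forall r s, D (r, s) ->
    continuity_2d_pt (fun u _ => sin (theta u)) r s /\
    continuity_2d_pt (fun u _ => p u) r s /\ continuity_2d_pt (fun u _ => q u) r s).
  { intros r s Hrs. destruct (sine_gordon_of_x D theta r s Htheta Hrs) as [C0 [C1 _]].
    assert (C2 : continuity_2d_pt (fun u _ => 2 * cos (theta u)) r s).
    { apply continuity_2d_pt_mult; [apply continuity_2d_pt_const|].
      apply (continuity_1d_2d_pt_comp cos (fun u _ => theta u));
        [apply continuity_cos|exact C0]. }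
    split; [|split].
    - apply (continuity_1d_2d_pt_comp sin (fun u _ => theta u));
        [apply continuity_sin|exact C0].
    - now apply continuity_2d_pt_minus.
    - now apply continuity_2d_pt_plus. }
  assert (Hder : forall r s, D (r, s) ->
    is_derive p r (2 * sin (theta r) * p r) /\
    is_derive q r (- (2 * sin (theta r)) * q r)).
  { intros r s Hrs. destruct (sine_gordon_of_x D theta r s Htheta Hrs) as [_ [_ [H1 H2]]].
    now apply is_derive_theta_combinations. }
  intros x y Hxy. split.
  - intros Hz. apply Hp0.
    apply (linear_total_equation_zero D (fun u _ => p u)
      (fun u _ => 2 * sin (theta u)) (fun _ _ => 0) HD) with (x0 := x) (y0 := y) (y := 0);
      [| |assumption|exact Hz|assumption].
    + intros r s Hrs. destruct (Hcont r s Hrs) as [Cs [Cp _]].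
      split; [exact Cp|split]; [|apply continuity_2d_pt_const].
      apply continuity_2d_pt_mult; [apply continuity_2d_pt_const|exact Cs].
    + intros r s Hrs. split; [now apply (Hder r s)|].
      rewrite Rmult_0_l. apply (is_derive_const (p r)).
  - apply Rminus_diag_uniq.
    apply (linear_total_equation_zero D (fun u _ => p u * q u - p 0 * q 0)
      (fun _ _ => 0) (fun _ _ => 0) HD) with (x0 := 0) (y0 := 0) (y := y);
      [| |assumption|ring|assumption].
    + intros r s Hrs. destruct (Hcont r s Hrs) as [_ [Cp Cq]].
      split; [|split; apply continuity_2d_pt_const].
      apply continuity_2d_pt_minus; [now apply continuity_2d_pt_mult|].
      apply continuity_2d_pt_const.
    + intros r s Hrs. destruct (Hder r s Hrs) as [Dp Dq].
      rewrite Rmult_0_l. split; [|apply (is_derive_const (p r * q r - p 0 * q 0))].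
      evar_last.
      * apply (is_derive_minus (fun t => p t * q t) (fun _ => p 0 * q 0));
          [|apply is_derive_const].
        apply (is_derive_mult p q); [exact Dp|exact Dq|exact Rmult_comm].
      * unfold minus, plus, opp, mult, zero; simpl. ring.
Qed.

(** The pair [A = cos (r y / 2 + k)], [B = r sin (r y / 2 + k)] is complex, but
    [r^2 = c] is real, hence its real and imaginary parts both satisfy
    [A' = - B / 2], [B' = c A / 2].  If [A = 0] at some point then [r sin = 0]
    there with [sin^2 = 1], so [r = 0]; but then [A = cos k], which is not zero. *)
Lemma riccati_tangent (D : R * R -> Prop) (S : R -> R -> R) (c : R) (r k : C) :
  plane_domain D -> D (0, 0) ->
  (forall x y, D (x, y) ->
     continuity_2d_pt S x y /\
     is_derive (fun t => S t y) x 0 /\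
     is_derive (fun t => S x t) y ((S x y * S x y + c) / 2)) ->
  (r * r)%C = RtoC c ->
  Ccos k <> RtoC 0 ->
  RtoC (S 0 0) = (r * Ctan k)%C ->
  forall x y, D (x, y) ->
    Ccos (r / RtoC 2 * RtoC y + k)%C <> RtoC 0 /\
    RtoC (S x y) = (r * Ctan (r / RtoC 2 * RtoC y + k))%C.
Proof.
  intros HD H0 HS Hr Hk Hi x y Hxy.
  set (z := fun t : R => (r / RtoC 2 * RtoC t + k)%C).
  assert (HAB : forall t,
    (is_derive (fun t => fst (Ccos (z t))) t (- fst (r * Csin (z t))%C / 2) /\
     is_derive (fun t => fst (r * Csin (z t))%C) t (c / 2 * fst (Ccos (z t)))) /\
    (is_derive (fun t => snd (Ccos (z t))) t (- snd (r * Csin (z t))%C / 2) /\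
     is_derive (fun t => snd (r * Csin (z t))%C) t (c / 2 * snd (Ccos (z t))))).
  { intros t.
    destruct (is_derive_Ccos_line (r / RtoC 2) k t) as [Hc1 Hc2].
    destruct (is_derive_Csin_line (r / RtoC 2) k t) as [Hs1 Hs2].
    fold (z t) in Hc1, Hc2, Hs1, Hs2.
    assert (Hhalf : (r / RtoC 2)%C = (fst r / 2, snd r / 2)).
    { destruct r. unfold Cdiv, Cinv, Cmult, RtoC; simpl. f_equal; field. }
    assert (Hr1 := f_equal fst Hr). assert (Hr2 := f_equal snd Hr). simpl in Hr1, Hr2.
    split; split; evar_last.
    - exact Hc1.
    - rewrite Hhalf. simpl. field.
    - apply (is_derive_minus (fun t => fst r * fst (Csin (z t)))
                             (fun t => snd r * snd (Csin (z t))));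
        [apply (is_derive_scal (fun t => fst (Csin (z t)))); exact Hs1
        |apply (is_derive_scal (fun t => snd (Csin (z t)))); exact Hs2].
    - unfold minus, plus, opp. rewrite Hhalf. destruct (Ccos (z t)) as [p q]. simpl.
      transitivity ((fst r * fst r - snd r * snd r) / 2 * p
        - (fst r * snd r + snd r * fst r) / 2 * q);
        [field|rewrite Hr1, Hr2; field].
    - exact Hc2.
    - rewrite Hhalf. simpl. field.
    - apply (is_derive_plus (fun t => fst r * snd (Csin (z t)))
                            (fun t => snd r * fst (Csin (z t))));
        [apply (is_derive_scal (fun t => snd (Csin (z t)))); exact Hs2
        |apply (is_derive_scal (fun t => fst (Csin (z t)))); exact Hs1].
    - unfold plus. rewrite Hhalf. destruct (Ccos (z t)) as [p q]. simpl.
      transitivity ((fst r * fst r - snd r * snd r) / 2 * q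
        + (fst r * snd r + snd r * fst r) / 2 * p);
        [field|rewrite Hr1, Hr2; field]. }
  assert (Hz0 : z 0 = k) by (unfold z; ring).
  assert (Hi' : (RtoC (S 0 0) * Ccos (z 0))%C = (r * Csin (z 0))%C).
  { rewrite Hz0, Hi. unfold Ctan. field. exact Hk. }
  assert (E : (RtoC (S x y) * Ccos (z y))%C = (r * Csin (z y))%C).
  { apply injective_projections.
    - transitivity (S x y * fst (Ccos (z y))); [simpl; ring|].
      apply (riccati_quotient D S (fun t => fst (Ccos (z t)))
               (fun t => fst (r * Csin (z t))%C) c HD H0 HS);
        [apply HAB| |exact Hxy].
      rewrite <- Hi'. simpl. ring.
    - transitivity (S x y * snd (Ccos (z y))); [simpl; ring|].
      apply (riccati_quotient D S (fun t => snd (Ccos (z t)))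
               (fun t => snd (r * Csin (z t))%C) c HD H0 HS);
        [apply HAB| |exact Hxy].
      rewrite <- Hi'. simpl. ring. }
  assert (Hcos : Ccos (z y) <> RtoC 0).
  { intros Hc0. rewrite Hc0 in E.
    assert (T := Csin2_Ccos2 (z y)). rewrite Hc0 in T.
    assert (Hr0 : r = RtoC 0).
    { transitivity (r * Csin (z y) * Csin (z y))%C.
      - transitivity (r * (Csin (z y) * Csin (z y) + RtoC 0 * RtoC 0))%C; [rewrite T|]; ring.
      - rewrite <- E. ring. }
    apply Hk. rewrite <- Hc0. unfold z. rewrite Hr0. f_equal. field. }
  split; [exact Hcos|].
  unfold Ctan. fold (z y).
  transitivity (RtoC (S x y) * Ccos (z y) / Ccos (z y))%C; [field; exact Hcos|].
  rewrite E. field. exact Hcos.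
Qed.

Theorem proposition16 (D : R * R -> Prop) (theta : R -> R) (w : R -> R -> R)
    (a b : R) (rab rq k : C)
    (HD : plane_domain D) (H0 : D (0, 0))
    (Htheta : sine_gordon D (fun x _ => theta x))
    (Hw : sinh_gordon D w)
    (Hwtheta : backlund D w (fun x _ => theta x))
    (Ha : a = 2 * cos (theta 0) + Derive theta 0)
    (Hb : b = 2 * cos (theta 0) - Derive theta 0)
    (Hb0 : b <> 0)
    (Hroots : compatible_roots a b rab rq)
    (Hcosk : Ccos k <> RtoC 0)
    (Hk : RtoC (tanh (w 0 0 / 2)) = (- rq * Ctan k)%C) :
  exists F G : R -> C,
    forall x y : R, D (x, y) ->
      Derive theta x - 2 * cos (theta x) <> 0 /\
      Ccos (rab / RtoC 2 * RtoC y + k)%C <> RtoC 0 /\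
      RtoC (tanh (w x y / 2)) = (F x * G y)%C /\
      (F x * G y)%C
        = (rab * Ctan (rab / RtoC 2 * RtoC y + k)
           / RtoC (Derive theta x - 2 * cos (theta x)))%C.
Proof.
  destruct Hroots as [Hsq [_ Hrab]].
  assert (Hp0 : Derive theta 0 - 2 * cos (theta 0) <> 0) by lra.
  assert (Hfac := theta_factors D theta HD H0 Htheta Hp0).
  replace ((Derive theta 0 - 2 * cos (theta 0)) * (Derive theta 0 + 2 * cos (theta 0)))
    with (- (a * b)) in Hfac by (rewrite Ha, Hb; ring).
  set (S := fun x y => (Derive theta x - 2 * cos (theta x)) * tanh (w x y / 2)).
  assert (HS : forall x y, D (x, y) ->
     continuity_2d_pt S x y /\
     is_derive (fun t => S t y) x 0 /\
     is_derive (fun t => S x t) y ((S x y * S x y + a * b) / 2)).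
  { intros x y Hxy.
    destruct (sine_gordon_of_x D theta x y Htheta Hxy) as [C0 [C1 [H1 H2]]].
    destruct (is_derive_theta_combinations theta x H1 H2) as [Hp _].
    destruct (backlund_tanh_half D theta w x y Hw Hwtheta Hxy) as [Tx Ty].
    destruct (Hfac x y Hxy) as [_ Hpq].
    split; [|split].
    - apply continuity_2d_pt_mult.
      + apply continuity_2d_pt_minus; [exact C1|].
        apply continuity_2d_pt_mult; [apply continuity_2d_pt_const|].
        apply (continuity_1d_2d_pt_comp cos (fun u _ => theta u));
          [apply continuity_cos|exact C0].
      + apply (continuity_1d_2d_pt_comp (fun s => tanh (s / 2)) w).
        * apply continuity_pt_filterlim.
          apply (ex_derive_continuous (fun s => tanh (s / 2))). eexists.
          apply (is_derive_tanh_half (fun s => s)), is_derive_id.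
        * now destruct (Hw x y Hxy) as [[Cw _] _].
    - evar_last.
      + apply (is_derive_mult _ (fun t => tanh (w t y / 2)) x _ _ Hp Tx Rmult_comm).
      + unfold plus, mult; simpl. ring.
    - evar_last.
      + apply (is_derive_scal (fun t => tanh (w x t / 2))); exact Ty.
      + unfold S. replace (a * b) with (- - (a * b)) by ring. rewrite <- Hpq. field. }
  (* The compatible choice of roots, [rab = b rq], together with [p = - b] at the
     origin, fixes the sign here. *)
  assert (Hk' : RtoC (S 0 0) = (rab * Ctan k)%C).
  { unfold S. rewrite RtoC_mult, Hk, Hrab.
    replace (Derive theta 0 - 2 * cos (theta 0)) with (- b) by lra.
    rewrite RtoC_opp. ring. }
  exists (fun x => (/ RtoC (Derive theta x - 2 * cos (theta x)))%C),
         (fun y => (rab * Ctan (rab / RtoC 2 * RtoC y + k))%C).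
  intros x y Hxy.
  destruct (Hfac x y Hxy) as [Hp _].
  destruct (riccati_tangent D S (a * b) rab k HD H0 HS Hsq Hcosk Hk' x y Hxy) as [Hc E].
  assert (HpC : RtoC (Derive theta x - 2 * cos (theta x)) <> RtoC 0).
  { intros Hz. now apply Hp, RtoC_inj. }
  split; [exact Hp|split; [exact Hc|split]].
  - rewrite <- E. unfold S. rewrite RtoC_mult. field. exact HpC.
  - apply Cmult_comm.
Qed.
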